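(* For every integer $m\ge0$, $$\sum_{\alpha\in\mathcal{P}^{\le m+1}}(q^\nu x)^{\mathrm{col}(\alpha)}(q^\nu)^{\mathrm{row}(\alpha)}q^{\mathrm{area}(\alpha)}=\frac{q^{2\nu+1}}{1-q^{\nu+1}}\cdot\frac{r^{(3)}_m(x^{-1};q^{\nu+2},q)}{r^{(3)}_{m+1}(x^{-1};q^{\nu+1},q)}.$$
   Context: $x$, $q$ and $q^\nu$ are regarded as independent indeterminates, and the left-hand side is a formal power series. The polynomials $r^{(3)}_n(x;c,q)$ are defined by $r^{(3)}_{-1}(x;c,q)=0$, $r^{(3)}_0(x;c,q)=1$ and, for $n\ge0$, $$r^{(3)}_{n+1}(x;c,q)=(x-\hat b_n)\,r^{(3)}_n(x;c,q)-x\,\hat a_n\,r^{(3)}_{n-1}(x;c,q),\quad \hat b_n=\frac{cq^n}{1-cq^n},\quad \hat a_n=\frac{c^2q^{2n-1}}{(1-cq^{n-1})(1-cq^n)}.$$ An NE-path is a lattice path from $(0,0)$ to $(s,t)$, for positive integers $s,t$, consisting of north steps $(0,1)$ and east steps $(1,0)$. A parallelogram polyomino is the set of unit squares enclosed by two NE-paths with the same ending point that do not intersect except at the starting and ending points. For a parallelogram polyomino $\alpha$, $\mathrm{col}(\alpha)$, $\mathrm{row}(\alpha)$ and $\mathrm{area}(\alpha)$ are its numbers of columns, rows and unit squares. A diagonal of $\alpha$ is the (nonempty) set of squares of $\alpha$ whose centers lie on a line $x+y=i$ for some integer $i$, and its size is its number of squares. $\mathcal{P}^{\le k}$ is the set of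 parallelogram polyominoes in which every diagonal has size at most $k$. *)

(* Defs.v *)
From HB Require Import structures.
From mathcomp Require Import all_boot all_order all_algebra.
From mathcomp Require Import finmap.
From mathcomp Require Import fraction.
From mathcomp Require Import boolp classical_sets functions cardinality fsbigop.

Set Implicit Arguments.
Unset Strict Implicit.
Unset Printing Implicit Defensive.

Import GRing.Theory.
Local Open Scope ring_scope.

Record fps (R : Type) := Fps { fps_coef :> nat -> R }.

HB.instance Definition _ (R : Type) := gen_eqMixin (fps R).
HB.instance Definition _ (R : Type) := gen_choiceMixin (fps R).

Lemma fpsP (R : Type) (f g : fps R) : (forall n, f n = g n) <-> f = g.
Proof.
split=> [|-> //]; case: f => f; case: g => g /= fg.
by congr Fps; apply: funext.
Qed.

Section FpsZmod.
Variable R : zmodType.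
Implicit Types f g h : fps R.

Definition fps_zero : fps R := Fps (fun=> 0).
Definition fps_opp f : fps R := Fps (fun n => - f n).
Definition fps_add f g : fps R := Fps (fun n => f n + g n).

Fact fps_addA : associative fps_add.
Proof. by move=> f g h; apply/fpsP => n /=; rewrite addrA. Qed.
Fact fps_addC : commutative fps_add.
Proof. by move=> f g; apply/fpsP => n /=; rewrite addrC. Qed.
Fact fps_add0 : left_id fps_zero fps_add.
Proof. by move=> f; apply/fpsP => n /=; rewrite add0r. Qed.
Fact fps_addN : left_inverse fps_zero fps_opp fps_add.
Proof. by move=> f; apply/fpsP => n /=; rewrite addNr. Qed.

HB.instance Definition _ :=
  GRing.isZmodule.Build (fps R) fps_addA fps_addC fps_add0 fps_addN.

End FpsZmod.

Section FpsRing.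
Variable R : comNzRingType.
Implicit Types f g h : fps R.

Definition fpsC (c : R) : fps R := Fps (fun n => if n == 0%N then c else 0).
Definition fpsX : fps R := Fps (fun n => (n == 1%N)%:R).
Definition fps_mul f g : fps R :=
  Fps (fun n => \sum_(j < n.+1) f j * g (n - j)%N).

Let trunc N f : {poly R} := \poly_(i < N) f i.

Fact fps_mul_trunc N f g n : (n < N)%N ->
  fps_mul f g n = (trunc N f * trunc N g)`_n.
Proof.
move=> nN; rewrite coefM /=; apply: eq_bigr => j _.
have jn : (j <= n)%N by rewrite -ltnS.
by rewrite !coef_poly (leq_ltn_trans jn nN) (leq_ltn_trans (leq_subr j n) nN).
Qed.

Fact fps_mulA : associative fps_mul.
Proof.
move=> f g h; apply/fpsP => n.
transitivity ((trunc n.+1 f * (trunc n.+1 g * trunc n.+1 h))`_n).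
  rewrite coefM /=; apply: eq_bigr => j _.
  by rewrite -fps_mul_trunc ?ltnS ?leq_subr // coef_poly ltn_ord.
rewrite mulrA coefM /=; apply: eq_bigr => j _.
by rewrite -fps_mul_trunc ?ltn_ord // coef_poly ltnS leq_subr.
Qed.

Fact fps_mulC : commutative fps_mul.
Proof.
move=> f g; apply/fpsP => n.
by rewrite !(@fps_mul_trunc n.+1) // mulrC.
Qed.

Fact fps_mul1 : left_id (fpsC 1) fps_mul.
Proof.
move=> f; apply/fpsP => n /=.
rewrite big_ord_recl /= mul1r subn0 big1 ?addr0 // => j _.
by rewrite mul0r.
Qed.

Fact fps_mulDl : left_distributive fps_mul +%R.
Proof.
move=> f g h; apply/fpsP => n /=; rewrite -big_split /=.
by apply: eq_bigr => j _; rewrite mulrDl.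
Qed.

Fact fps_one_neq0 : fpsC 1 != 0.
Proof.
apply/eqP => /fpsP /(_ 0%N) /= /eqP.
by rewrite oner_eq0.
Qed.

HB.instance Definition _ := GRing.Zmodule_isComNzRing.Build (fps R)
  fps_mulA fps_mulC fps_mul1 fps_mulDl fps_one_neq0.

Lemma fps_coefM f g n : (f * g) n = \sum_(j < n.+1) f j * g (n - j)%N.
Proof. by []. Qed.

Definition fps_unit : pred (fps R) := fun f => `[< exists g, g * f = 1 >].
Definition fps_inv f : fps R :=
  if pselect (exists g, g * f = 1) is left fU then projT1 (cid fU) else f.

Fact fps_mulVf : {in fps_unit, left_inverse 1 fps_inv *%R}.
Proof.
move=> f /asboolP fU; rewrite /fps_inv.
by case: pselect => [fU'|//]; case: cid.
Qed.

Fact fps_unitP f g : g * f = 1 -> fps_unit f.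
Proof. by move=> gf1; apply/asboolP; exists g. Qed.

Fact fps_inv_out : {in [predC fps_unit], fps_inv =1 id}.
Proof.
move=> f fNU; rewrite /fps_inv; case: pselect => // fU.
by case/negP: fNU; apply/asboolP.
Qed.

HB.instance Definition _ := GRing.ComNzRing_hasMulInverse.Build (fps R)
  fps_mulVf fps_unitP fps_inv_out.

End FpsRing.

Section FpsIdomain.
Variable R : idomainType.

Fact fps_order (f : fps R) : f != 0 ->
  exists n, f n != 0 /\ forall k, (k < n)%N -> f k = 0.
Proof.
move=> f_neq0; have exf : exists n, f n != 0.
  apply: contrapT => f0; case/eqP: f_neq0; apply/fpsP => n.
  by apply/eqP/negPn/negP => fn; apply: f0; exists n.
exists (ex_minn exf); case: ex_minnP => n fn nmin; split=> // k kn.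
by apply/eqP/negPn/negP => /nmin; rewrite leqNgt kn.
Qed.

Fact fps_idomain : GRing.integral_domain_axiom (fps R).
Proof.
move=> f g fg0; apply/norP => -[/fps_order[n [fn fk]] /fps_order[m [gm gk]]].
move/fpsP/(_ (n + m)%N): fg0; rewrite fps_coefM.
have ltn_nm : (n < (n + m).+1)%N by rewrite ltnS leq_addr.
rewrite (bigD1 (Ordinal ltn_nm)) //= addKn big1 ?addr0 => [|j jn].
  by move/eqP; rewrite mulf_eq0 (negPf fn) (negPf gm).
have [jltn|nltj|eqjn] := ltngtP j n; first by rewrite fk ?mul0r.
  rewrite gk ?mulr0 // ltn_subLR; last by rewrite -ltnS.
  by rewrite ltn_add2r.
by case/eqP: jn; apply: val_inj.
Qed.

HB.instance Definition _ :=
  GRing.ComUnitRing_isIntegral.Build (fps R) fps_idomain.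

End FpsIdomain.

(* QQ[[x, q^nu, q]] as the iterated ring QQ[[q]][[q^nu]][[x]]: the coefficient
   of x^i (q^nu)^j q^k in f is [f i j k]. *)
Definition fps3 : idomainType := fps (fps (fps rat)).
Definition var_x : fps3 := fpsX _.
Definition var_qnu : fps3 := fpsC (fpsX _).
Definition var_q : fps3 := fpsC (fpsC (fpsX _)).

(* Formal sum of a family of series, computed coefficientwise. It is meant for
   families in which each monomial has a nonzero coefficient in only finitely
   many members (a finitely supported sum has the junk value 0 otherwise). *)
Definition fps3_sum (I : choiceType) (A : set I) (F : I -> fps3) : fps3 :=
  Fps (fun i => Fps (fun j => Fps (fun k =>
    \sum_(a \in A) (F a : fps (fps (fps rat))) i j k))).

Section R3.
Variables (F : fieldType) (c q : F).

Definition bhat (n : nat) : F := c * q ^+ n / (1 - c * q ^+ n).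

(* The exponents are integers: at n = 0 they are negative. *)
Definition ahat (n : nat) : F :=
  c ^+ 2 * q ^ (2 * n%:Z - 1) / ((1 - c * q ^ (n%:Z - 1)) * (1 - c * q ^ n%:Z)).

(* [r3_shift n] is r_(n - 1), so that the recurrence starts from r_(-1) = 0. *)
Fixpoint r3_shift (n : nat) : {poly F} :=
  match n with
  | 0 => 0
  | n1.+1 =>
    match n1 with
    | 0 => 1
    | n2.+1 =>
      ('X - (bhat n2)%:P) * r3_shift n1 - 'X * (ahat n2)%:P * r3_shift n2
    end
  end.

Definition r3 (n : nat) : {poly F} := r3_shift n.+1.

End R3.

(* An NE-path is the sequence of its steps: [true] is a north step (0,1) and
   [false] an east step (1,0). *)
Definition NE_path := seq bool.

Definition vertex (p : NE_path) (k : nat) : nat * nat :=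
  (count negb (take k p), count id (take k p)).

Definition vertices (p : NE_path) : seq (nat * nat) :=
  [seq vertex p k | k <- iota 0 (size p).+1].

Definition endpoint (p : NE_path) : nat * nat := vertex p (size p).

(* The unit square [i, i + 1] x [j, j + 1] is represented by (i, j). The
   vertical upward ray from its center meets [p] exactly when [p] has an east
   step from (i, h) to (i + 1, h) with j < h. *)
Definition crosses_above (p : NE_path) (c : nat * nat) : bool :=
  has (fun k => [&& ~~ nth true p k, (vertex p k).1 == c.1
                  & (c.2 < (vertex p k).2)%N]) (iota 0 (size p)).

(* An NE-path meets the vertical line through a center at most once, so the
   even-odd rule applied to that ray decides whether a square is enclosed. *)
Definition enclosed (p p' : NE_path) (c : nat * nat) : bool :=
  crosses_above p c (+) crosses_above p' c.

Definition meet_only_at_ends (p p' : NE_path) : Prop :=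
  forall v, v \in vertices p -> v \in vertices p' ->
    v = (0%N, 0%N) \/ v = endpoint p.

Definition parallelogram_polyomino (alpha : {fset nat * nat}) : Prop :=
  exists p p' : NE_path,
    [/\ (0 < (endpoint p).1)%N /\ (0 < (endpoint p).2)%N,
        endpoint p' = endpoint p,
        meet_only_at_ends p p'
      & forall c, (c \in alpha) = enclosed p p' c].

Definition ncols (alpha : {fset nat * nat}) : nat :=
  #|` [fset c.1 | c in alpha]%fset|.
Definition nrows (alpha : {fset nat * nat}) : nat :=
  #|` [fset c.2 | c in alpha]%fset|.
Definition area (alpha : {fset nat * nat}) : nat := #|` alpha|.

(* The center of (a, b) is (a + 1/2, b + 1/2), on the line x + y = a + b + 1. *)
Definition diagonal (alpha : {fset nat * nat}) (i : nat) : {fset nat * nat} :=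
  [fset c in alpha | (c.1 + c.2).+1 == i]%fset.

Definition polyominoes_le (k : nat) : set {fset nat * nat} :=
  [set alpha | parallelogram_polyomino alpha /\
     forall i, (#|` diagonal alpha i| <= k)%N]%classic.

(* Main.v *)
From mathcomp Require Import all_boot all_order all_algebra fraction finmap.
From mathcomp Require Import zify ring.
From mathcomp Require Import classical_sets fsbigop.
Require Import Defs.

Import GRing.Theory.

(** Cut a parallelogram polyomino along the lines x + y = k. Its two boundary
    paths have the same length n and meet the line x + y = k in one vertex each;
    the squares centred on that line are exactly those between the two vertices,
    so the diagonal of index k has as many squares as the horizontal distance
    d_k of the two vertices. Reading the two paths simultaneously, step by step,
    the polyomino becomes a word of pairs of steps, whose height d_k goes up by
    one when the upper path goes north and the lower one east, down by one in
    the opposite case, and stays put in the two remaining ones: a Motzkin path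
    with two kinds of level steps. Diagonals of size at most K mean that the
    heights stay at most K, the area is the sum of the heights, n is the number
    of columns plus the number of rows, and the columns are counted by the east
    steps of the upper path ([polyominoes_leE], [polyomino_of_inj],
    [ncols_polyomino_of], [semiperimeter_polyomino_of], [area_polyomino_of]).

    Write v for q^nu, and g_h for the generating function of the words that lead
    from height h to height 0 inside the strip 1..K. Removing the first letter
    gives ([strip_gfS])
      g_h = v q^h (g_(h+1) + (1 + x) g_h + x g_(h-1)),  g_0 = 1,  g_(K+1) = 0,
    and the polyominoes are counted by v g_1 ([polyomino_gf]), because the first
    letter is forced. This tridiagonal system is solved for g_1 by eliminating
    upwards: with suitable explicit products W_h,
      D_h g_1 = v q / (1 - v q) N_h + W_h g_(h+1)          ([elimination])
    where D_h = r_h(1/x; v q, q) and N_h = r_(h-1)(1/x; v q^2, q). Both sequences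
    obey the same three-term recurrence, since passing from c to c q shifts the
    coefficients of the recurrence by one. At h = K = m + 1 the last term
    vanishes and g_1 is the announced quotient. The denominator D_K is nonzero
    because the Casoratian of D and N never vanishes ([casoratian_neq0]). *)

(** * Parallelogram polyominoes *)

Local Arguments vertex : simpl never.

(** The vertex of p on the line x + y = k has abscissa [easts p k]; beyond the
    end of p this stays at the abscissa of the endpoint. *)
Definition easts (p : NE_path) (k : nat) : nat := count negb (take k p).

Local Arguments easts : simpl never.

Lemma easts0 p : easts p 0 = 0%N.
Proof. by rewrite /easts take0. Qed.

Lemma eastsS p k : (k < size p)%N -> easts p k.+1 = (easts p k + ~~ nth true p k)%N.
Proof.
by move=> kp; rewrite /easts (take_nth true) // -cats1 count_cat /= addn0.
Qed.

Lemma easts_mono p : {homo easts p : j k / (j <= k)%N}.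
Proof.
move=> j k jk; rewrite /easts -(subnKC jk) takeD count_cat; exact: leq_addr.
Qed.

Lemma easts_lip p j k : (j <= k)%N -> (easts p k <= easts p j + (k - j))%N.
Proof.
move=> jk; rewrite /easts -{1}(subnKC jk) takeD count_cat leq_add2l.
by rewrite (leq_trans (count_size _ _)) // size_take_min geq_minl.
Qed.

Lemma eastsS_le p k : (easts p k.+1 <= (easts p k).+1)%N.
Proof. by have := easts_lip p k k.+1 (leqnSn k); rewrite subSnn addn1. Qed.

Lemma easts_oversize p k : (size p <= k)%N -> easts p k = easts p (size p).
Proof. by move=> pk; rewrite /easts take_oversize // take_size. Qed.

Lemma easts_max p k : (easts p k <= easts p (size p))%N.
Proof.
have := @easts_mono p k (maxn k (size p)) (leq_maxl _ _).
by rewrite [easts p (maxn _ _)]easts_oversize ?leq_maxr.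
Qed.

Lemma vertexE p k : (k <= size p)%N -> vertex p k = (easts p k, k - easts p k)%N.
Proof.
move=> kp; congr pair.
have := count_predC negb (take k p); rewrite size_takel // -/(easts p k).
rewrite (@eq_count _ (predC negb) id) => [|b]; last by rewrite /= negbK.
lia.
Qed.

Lemma easts_le p k : (easts p k <= k)%N.
Proof. by rewrite (leq_trans (count_size _ _)) // size_take_min geq_minl. Qed.

Lemma easts_hit p a : (a < easts p (size p))%N ->
  exists k, [/\ (k < size p)%N, easts p k = a & nth true p k = false].
Proof.
move=> aE.
have ex : exists k, (a < easts p k)%N by exists (size p).
case: (ex_minnP ex) => -[|k] ak kmin; first by rewrite easts0 in ak.
have kp : (k < size p)%N by apply: kmin.
have ka : (easts p k <= a)%N by rewrite leqNgt; apply/negP => /kmin; rewrite ltnn.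
by exists k; move: ak; rewrite eastsS //; case: (nth true p k) => /=; split=> //; lia.
Qed.

(** The path p passes through (e, k - e), with k = a + b + 1 and e = [easts p k].
    If e <= a, it can only cross the column a later, hence above the square
    (a, b); if a < e, it has crossed that column earlier, hence below. *)
Lemma crosses_aboveE p a b :
  crosses_above p (a, b) = (easts p (a + b).+1 <= a < easts p (size p))%N.
Proof.
apply/hasP/andP => [[k] | [ea aE]].
  rewrite mem_iota add0n => /andP[_ kp]; rewrite (vertexE _ _ (ltnW kp)) /=.
  case/and3P=> nk /eqP ek bk.
  have := @easts_mono p (a + b).+1 k; have := @easts_mono p k.+1 (size p) kp.
  rewrite eastsS // nk /= ek; lia.
have [k [kp ek nk]] := @easts_hit p a aE.
exists k; first by rewrite mem_iota.
rewrite nk (vertexE _ _ (ltnW kp)) /= ek eqxx /=.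
have [kab|abk] := ltnP k (a + b).+1; last by lia.
have := @easts_mono p k.+1 (a + b).+1 kab; rewrite eastsS // nk /=; lia.
Qed.

(** On a line x + y = k, the higher vertex is the one with fewer east steps. The
    length is required to exceed 1 so that there is a vertex between the ends. *)
Definition above (p p' : NE_path) : Prop :=
  [/\ (1 < size p)%N, size p' = size p, easts p' (size p) = easts p (size p)
    & forall k, (0 < k < size p)%N -> (easts p k < easts p' k)%N].

Definition cells_between (p p' : NE_path) : {fset nat * nat} :=
  [fset c in [seq (a, b) | a <- iota 0 (size p), b <- iota 0 (size p)] |
    easts p (c.1 + c.2).+1 <= c.1 < easts p' (c.1 + c.2).+1]%fset.

(** Discrete continuity: take the first k with a < g (k + 1). Applied to the
    east counts, and then to the north counts, of the two boundary paths it shows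
    that no column and no row of the bounding box is empty. The last step
    k + 1 = n is excluded: f (n - 1) < g (n - 1) <= a would leave f a jump of at
    least 2 to reach g n > a. *)
Lemma straddled (f g : nat -> nat) n a : (1 < n)%N -> g 0%N = 0%N -> f n = g n ->
  (forall k, (f k.+1 <= (f k).+1)%N) -> (forall k, (g k.+1 <= (g k).+1)%N) ->
  (forall k, (0 < k < n)%N -> (f k < g k)%N) -> (a < g n)%N ->
  exists k, (f k.+1 <= a < g k.+1)%N.
Proof.
move=> n1 g0 fgn fS gS fg an.
have ex : exists k, (a < g k)%N by exists n.
case: (ex_minnP ex) => -[|k] ak kmin; first by rewrite g0 in ak.
have kn : (k.+1 <= n)%N by apply: kmin.
have ka : (g k <= a)%N by rewrite leqNgt; apply/negP => /kmin; rewrite ltnn.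
exists k; rewrite ak andbT; have [kn1|kn1] := ltnP k.+1 n.
  by have := fg k.+1 kn1; have := gS k; lia.
have k0 : (0 < k < n)%N by lia.
by have := fg k k0; have := fS k; lia.
Qed.

Section Above.
Variables p p' : NE_path.
Hypothesis pp' : above p p'.

Lemma above_le k : (easts p k <= easts p' k)%N.
Proof.
case: pp' => p1 sp' ep lt_pp'.
have [kp|pk] := ltnP k (size p); last first.
  by rewrite (@easts_oversize p') ?sp' // (@easts_oversize p) // ep.
by case: k kp => [|k] kp; [rewrite !easts0 | apply/ltnW/lt_pp'].
Qed.

(** The square (a, b) is centred on the line x + y = a + b + 1, so it lies between
    the paths when a lies between their abscissas on that line. *)
Lemma in_cells_between a b : ((a, b) \in cells_between p p') =
  (easts p (a + b).+1 <= a < easts p' (a + b).+1)%N.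
Proof.
case: pp' => p1 sp' ep lt_pp'.
rewrite !inE /=; apply: andb_idl => /andP[ea aE].
have abp : ((a + b).+1 < size p)%N.
  rewrite ltnNge; apply/negP => pab; move: ea aE.
  rewrite (@easts_oversize p') ?sp' // (@easts_oversize p) // ep; lia.
by apply/allpairsP; exists (a, b); rewrite !mem_iota /=; split=> //; lia.
Qed.

Lemma enclosed_cells_between c : enclosed p p' c = (c \in cells_between p p').
Proof.
case: c => a b; rewrite in_cells_between /enclosed !crosses_aboveE.
case: (pp') => p1 sp' ep lt_pp'; rewrite sp' ep.
have := above_le (a + b).+1.
have := easts_max p' (a + b).+1; rewrite sp' ep.
by case: leqP; case: leqP; case: leqP => //=; lia.
Qed.

Lemma cells_between_diag a b : (a, b) \in cells_between p p' -> ((a + b).+1 < size p)%N.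
Proof.
case: (pp') => p1 sp' ep lt_pp'.
rewrite in_cells_between => /andP[ea aE].
rewrite ltnNge; apply/negP => pab; move: ea aE.
rewrite (@easts_oversize p') ?sp' // (@easts_oversize p) // ep; lia.
Qed.

(** The square (a, b) of the diagonal k is determined by a, which ranges over the
    interval between the abscissas of the two vertices. *)
Lemma card_diagonal k :
  #|` diagonal (cells_between p p') k| = (easts p' k - easts p k)%N.
Proof.
case: k => [|k].
  rewrite !easts0 /=; apply/eqP; rewrite cardfs_eq0; apply/eqP/fsetP => c.
  by rewrite !inE andbF.
have -> : diagonal (cells_between p p') k.+1 =
  [fset (a, k - a)%N | a in iota (easts p k.+1) (easts p' k.+1 - easts p k.+1)]%fset.
  apply/fsetP => -[a b]; rewrite in_fset inE in_cells_between /=.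
  have := easts_le p' k.+1; have := above_le k.+1 => le1 le2.
  apply/andP/imfsetP => /= [[] | [a']].
    move=> /[swap] /eqP [<-] ab; exists a; last by rewrite addKn.
    by rewrite mem_iota; lia.
  rewrite mem_iota => a'in [-> ->].
  have -> : (a' + (k - a') = k)%N by lia.
  by rewrite eqxx; split=> //; lia.
rewrite card_imfset /=; last by move=> ? ? [].
by rewrite undup_id ?iota_uniq // size_iota.
Qed.

Lemma area_cells_between :
  area (cells_between p p') = (\sum_(k < size p) (easts p' k - easts p k))%N.
Proof.
rewrite /area card_fset_sum1.
under [RHS]eq_bigr => k _ do rewrite -card_diagonal card_fset_sum1 big_fset /=.
rewrite (exchange_big_dep xpredT) //= big_seq [RHS]big_seq.
apply: eq_bigr => -[a b] /cells_between_diag ab /=.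
by rewrite (big_pred1 (Ordinal ab)) // => k; rewrite eq_sym.
Qed.

Lemma ncols_cells_between : ncols (cells_between p p') = easts p (size p).
Proof.
case: (pp') => p1 sp' ep lt_pp'.
rewrite /ncols -[RHS](size_iota 0) -[in RHS](undup_id (iota_uniq 0 _)) -card_fseq.
congr #|` _|; apply/fsetP => a; rewrite !inE mem_iota add0n /=.
apply/imfsetP/idP => /= [[[a' b] ab ->] | aE].
  move: ab; rewrite in_cells_between => /andP[_ /leq_trans]; apply.
  by rewrite -ep -sp' easts_max.
have [|||||||k /andP[lk kl]] := @straddled (easts p) (easts p') (size p) a.
all: rewrite ?sp' ?ep //.
- by rewrite easts0.
- exact: eastsS_le.
- exact: eastsS_le.
exists (a, k - a)%N => //; rewrite in_cells_between.
by rewrite subnKC ?lk // -ltnS (leq_trans kl) ?easts_le.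
Qed.

Lemma nrows_cells_between : nrows (cells_between p p') = (size p - easts p (size p))%N.
Proof.
case: (pp') => p1 sp' ep lt_pp'.
rewrite /nrows -[RHS](size_iota 0) -[in RHS](undup_id (iota_uniq 0 _)) -card_fseq.
congr #|` _|; apply/fsetP => b; rewrite !inE mem_iota add0n /=.
apply/imfsetP/idP => /= [[[a b'] ab ->] | bN].
  have /= := cells_between_diag _ _ ab; move: ab; rewrite in_cells_between.
  have := easts_lip p (a + b').+1 (size p); lia.
have [|||||||k /andP[lk kl]] :=
  @straddled (fun k => k - easts p' k)%N (fun k => k - easts p k)%N (size p) b.
all: rewrite ?sp' ?ep //.
- by move=> k; have := @easts_mono p' k k.+1; lia.
- by move=> k; have := @easts_mono p k k.+1; lia.
- by move=> k kn; have := lt_pp' k kn; have := easts_le p' k; lia.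
exists (k - b, b)%N => //; rewrite in_cells_between.
by rewrite subnK; lia.
Qed.

End Above.

Lemma sum_vertex p k : (k <= size p)%N -> ((vertex p k).1 + (vertex p k).2 = k)%N.
Proof. by move=> kp; rewrite vertexE //= subnKC // easts_le. Qed.

Lemma verticesP p v :
  reflect (exists2 k, (k <= size p)%N & v = vertex p k) (v \in vertices p).
Proof.
apply: (iffP mapP) => -[k kp ->]; exists k => //.
  by move: kp; rewrite mem_iota.
by rewrite mem_iota.
Qed.

(** With [above_meet], this shows that a pair of strictly separated paths bounds
    a polyomino; conversely [meet_above] orders the two boundary paths. *)
Lemma above_endpoint p p' : above p p' ->
  [/\ (0 < (endpoint p).1)%N, (0 < (endpoint p).2)%N & endpoint p' = endpoint p].
Proof.
case=> p1 sp' ep lt_pp'; rewrite /endpoint sp' !vertexE ?sp' //= ep.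
have := lt_pp' 1%N p1; have := easts_max p' 1; rewrite sp' ep.
have := easts_le p' 1; have := @easts_lip p 1 (size p) (ltnW p1).
by move=> *; split=> //; lia.
Qed.

Lemma above_meet p p' : above p p' -> meet_only_at_ends p p'.
Proof.
case=> p1 sp' ep lt_pp' v /verticesP[k kp ->] /verticesP[k'].
rewrite sp' => kp' vv; have kk' : k = k'.
  by rewrite -(sum_vertex p k kp) vv sum_vertex // sp'.
move: vv; rewrite -kk' !vertexE ?sp' // => -[ekk _].
case: (posnP k) => [->|k0]; first by left; rewrite easts0.
case: (ltnP k (size p)) => [kn|nk].
  by have := lt_pp' k; rewrite k0 kn ekk ltnn => /(_ isT).
right; have -> : k = size p by lia.
by rewrite /endpoint vertexE.
Qed.

Lemma meet_only_at_endsC p p' :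
  endpoint p' = endpoint p -> meet_only_at_ends p p' -> meet_only_at_ends p' p.
Proof. by move=> ep pp' v vp' vp; rewrite ep; apply: pp'. Qed.

(** Two NE-paths cannot exchange their order without meeting: their abscissas on
    x + y = k change by 0 or 1 when k grows by one. So the order after the first
    step persists. *)
Lemma meet_above p p' : (1 < size p)%N -> endpoint p' = endpoint p ->
  meet_only_at_ends p p' -> (easts p 1 <= easts p' 1)%N -> above p p'.
Proof.
move=> p1 ep meet le1.
have sp' : size p' = size p.
  by rewrite -(sum_vertex p' _ (leqnn _)) -(sum_vertex p _ (leqnn _)) -/(endpoint p') ep.
have neq k : (0 < k < size p)%N -> easts p k != easts p' k.
  move=> /andP[k0 kn]; apply/eqP => ekk.
  have vv : vertex p k = vertex p' k by rewrite !vertexE ?sp' ?(ltnW kn) // ekk.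
  have vp : vertex p k \in vertices p by apply/verticesP; exists k => //; apply: ltnW.
  have vp' : vertex p k \in vertices p'.
    by apply/verticesP; exists k => //; rewrite sp' ltnW.
  have := sum_vertex p k (ltnW kn).
  case: (meet _ vp vp') => ->; first by move=> k00; rewrite -k00 in k0.
  by rewrite /endpoint sum_vertex // => ks; rewrite ks ltnn in kn.
split=> //.
  by move: ep; rewrite /endpoint sp' !vertexE ?sp' // => -[].
elim=> // k IH /= kn; case: k => [|k] in IH kn *.
  by rewrite ltn_neqAle le1 andbT neq.
rewrite ltn_neqAle neq //=.
have := IH (ltnW kn); have := eastsS_le p k.+1; have := @easts_mono p' k.+1 k.+2; lia.
Qed.

Lemma parallelogram_polyominoP alpha : parallelogram_polyomino alpha <->
  exists p p', above p p' /\ alpha = cells_between p p'.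
Proof.
split=> [[p [p' [[E0 N0] ep meet alphaE]]] | [p [p' [pp' ->]]]]; last first.
  have [E0 N0 ep] := above_endpoint _ _ pp'.
  exists p, p'; split=> //; first exact: above_meet.
  by move=> c; rewrite enclosed_cells_between.
have p1 : (1 < size p)%N.
  by rewrite -(sum_vertex p _ (leqnn _)) -/(endpoint p); lia.
case: (leqP (easts p 1) (easts p' 1)) => [|/ltnW] le1.
  have pp' := meet_above _ _ p1 ep meet le1.
  by exists p, p'; split=> //; apply/fsetP => c; rewrite alphaE enclosed_cells_between.
have p1' : (1 < size p')%N.
  by rewrite -(sum_vertex p' _ (leqnn _)) -/(endpoint p') ep; lia.
have p'p := meet_above _ _ p1' (esym ep) (meet_only_at_endsC _ _ ep meet) le1.
exists p', p; split=> //; apply/fsetP => c.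
by rewrite alphaE -enclosed_cells_between // /enclosed addbC.
Qed.

Lemma eq_easts p r : size p = size r -> easts p =1 easts r -> p = r.
Proof.
move=> spr epr; apply: (@eq_from_nth _ true) => // k kp.
have := epr k.+1; rewrite !eastsS -?spr // epr => /addnI.
by case: nth; case: nth.
Qed.

Lemma cells_between_sub p p' r r' k : above p p' -> above r r' ->
  cells_between p p' = cells_between r r' -> (0 < k < size p)%N ->
  (easts r k <= easts p k)%N /\ (easts p' k <= easts r' k)%N.
Proof.
move=> pp' rr' eq_int kp.
have lt_ee : (easts p k < easts p' k)%N by case: pp' => _ _ _; apply.
have le_ek := easts_le p' k.
have H a : (easts p k <= a < easts p' k)%N -> (easts r k <= a < easts r' k)%N.
  have [ak|ka] := leqP a.+1 k; last by lia.
  have := in_cells_between _ _ rr' a (k - a.+1); rewrite -eq_int in_cells_between //.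
  by rewrite -addSn subnKC // => ->.
have := H (easts p k); have := H (easts p' k).-1; lia.
Qed.

(** The two boundary paths are recovered from the squares: the numbers of columns
    and rows give the endpoint and the length, and each diagonal gives, by its
    first and last square, the two vertices on its line. *)
Lemma cells_between_inj p p' r r' : above p p' -> above r r' ->
  cells_between p p' = cells_between r r' -> p = r /\ p' = r'.
Proof.
move=> pp' rr' eq_int.
have Epr : easts p (size p) = easts r (size r).
  by rewrite -!(ncols_cells_between _ _ pp', ncols_cells_between _ _ rr') eq_int.
have spr : size p = size r.
  have := nrows_cells_between _ _ pp'; rewrite eq_int nrows_cells_between // Epr.
  by have := easts_le p (size p); have := easts_le r (size r); lia.
have [_ sp' ep' _] := pp'; have [_ sr' er' _] := rr'.
have H k : easts p k = easts r k /\ easts p' k = easts r' k.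
  case: (posnP k) => [->|k0]; first by rewrite !easts0.
  case: (ltnP k (size p)) => [kn|nk]; last first.
    rewrite !(easts_oversize p, easts_oversize r, easts_oversize p', easts_oversize r');
      rewrite ?sp' ?sr' -?spr //.
    by rewrite ep' Epr -er' spr.
  have kp : (0 < k < size p)%N by rewrite k0.
  have kr : (0 < k < size r)%N by rewrite -spr.
  have [] := cells_between_sub _ _ _ _ k pp' rr' eq_int kp.
  have [] := cells_between_sub _ _ _ _ k rr' pp' (esym eq_int) kr.
  by split; lia.
by split; apply: eq_easts; rewrite ?sp' ?sr' // => k; case: (H k).
Qed.

(** * Words of pairs of steps *)

(** A letter is a simultaneous step of the upper and of the lower path, in this
    order, with [true] for north; the distance between the paths grows by the
    first component and decreases by the second. The truncation of the
    subtraction has no effect at a positive height. *)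
Definition next_height (h : nat) (s : bool * bool) : nat := (h + s.1 - s.2)%N.

(** The heights stay in 1..K up to the end of the word, where 0 is reached: this
    is the reunion of the two paths at the upper right corner. *)
Fixpoint strip (K h : nat) (w : seq (bool * bool)) : bool :=
  if w is s :: w' then (0 < h <= K)%N && strip K (next_height h s) w' else h == 0%N.

(** The sum of the heights, which are the sizes of the diagonals. *)
Fixpoint word_area (h : nat) (w : seq (bool * bool)) : nat :=
  if w is s :: w' then (h + word_area (next_height h s) w')%N else 0%N.

Lemma easts_cons b p k : easts (b :: p) k.+1 = (~~ b + easts p k)%N.
Proof. by []. Qed.

(** The height after k letters is h plus the east steps of the lower path minus
    those of the upper one; the inequalities avoid the subtraction. *)
Lemma stripP K h w : strip K h w <->
  (forall k, (k < size w)%N ->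
     easts (unzip1 w) k < h + easts (unzip2 w) k <= K + easts (unzip1 w) k)%N /\
  (h + easts (unzip2 w) (size w) = easts (unzip1 w) (size w))%N.
Proof.
elim: w h => [|[u l] w IH] h /=.
  by rewrite /easts /= addn0; split=> [/eqP->|[_ ->]].
split=> [/andP[hK /IH[bnd fin]] | [bnd fin]].
  split=> [[|k] kw|].
  - by rewrite !easts0 /=; lia.
  - rewrite !easts_cons; have := bnd k kw; rewrite /next_height /=.
    by case: u {IH bnd fin}; case: l => /=; lia.
  - move: fin; rewrite !easts_cons /next_height.
    by case: u {IH bnd}; case: l => /=; lia.
have := bnd 0%N isT; rewrite !easts0 /= !addn0 => hK; rewrite hK /=.
apply/IH; split=> [k kw|].
  have := bnd k.+1 kw; rewrite !easts_cons /next_height.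
  by case: u {IH bnd fin}; case: l => /=; lia.
move: fin; rewrite !easts_cons /next_height.
by case: u {IH bnd}; case: l => /=; lia.
Qed.

Lemma word_areaE K h w : strip K h w ->
  word_area h w = (\sum_(k < size w) (h + easts (unzip2 w) k - easts (unzip1 w) k))%N.
Proof.
elim: w h => [|[u l] w IH] h; first by rewrite /= big_ord0.
move=> /andP[hK /IH /= ->]; rewrite big_ord_recl !easts0 addn0 subn0.
congr addn; apply: eq_bigr => k _.
rewrite !lift0 !easts_cons /next_height.
by case: u; case: l => /=; lia.
Qed.

(** The first letter of a polyomino is always (north, east), which leads from
    distance 0 to distance 1; w is the rest of the word. *)
Definition polyomino_of (w : seq (bool * bool)) : {fset nat * nat} :=
  cells_between (true :: unzip1 w) (false :: unzip2 w).

Lemma strip_above K w : strip K 1 w -> above (true :: unzip1 w) (false :: unzip2 w).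
Proof.
move=> /[dup] sw /stripP[bnd fin]; split=> /=; rewrite ?size_map //.
- by rewrite ltnS; case: w sw {bnd fin}.
by case=> // k /=; rewrite ltnS => /bnd; rewrite !easts_cons /=; lia.
Qed.

(** The heights of the word are the sizes of the diagonals ([card_diagonal]), so
    the bound on the diagonals is the bound of the strip. *)
Lemma polyominoes_leE K :
  polyominoes_le K = [set polyomino_of w | w in [set w | strip K 1 w]]%classic.
Proof.
apply/seteqP; split=> [alpha /= [/parallelogram_polyominoP[p [p' [pp' ->]]]] diag|].
  have [p1 sp' ep lt_pp'] := pp'.
  have := lt_pp' 1%N p1.
  case: p => [|u p] in pp' diag p1 sp' ep lt_pp' *; first by [].
  case: p' => [|l p'] in pp' diag sp' ep lt_pp' *; first by [].
  rewrite !easts_cons !easts0 /= !addn0.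
  case: u in pp' diag p1 sp' ep lt_pp' *; last by case: (l).
  case: l in pp' diag sp' ep lt_pp' * => // _.
  case: sp' => sp'.
  have u1 : unzip1 (zip p p') = p by rewrite unzip1_zip ?sp'.
  have u2 : unzip2 (zip p p') = p' by rewrite unzip2_zip ?sp'.
  exists (zip p p'); last by rewrite /polyomino_of u1 u2.
  apply/stripP; rewrite u1 u2 size_zip sp' minnn; split=> [k kp|].
    have := lt_pp' k.+1; have := diag k.+1; rewrite card_diagonal // !easts_cons /=.
    by rewrite ltnS; lia.
  by move: ep => /=; rewrite !easts_cons.
move=> _ [w /= sw <-]; have aw := strip_above K w sw; split.
  by apply/parallelogram_polyominoP; eexists _, _; split; first exact: aw.
move=> k; rewrite card_diagonal //; have [bnd fin] := (stripP _ _ _).1 sw.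
case: k => [|k]; first by rewrite !easts0.
rewrite !easts_cons /=; case: (ltnP k (size w)) => [/bnd|wk]; first by lia.
by rewrite !easts_oversize ?size_map //; lia.
Qed.

Lemma polyomino_of_inj K : {in [set w | strip K 1 w]%classic &, injective polyomino_of}.
Proof.
move=> w w'; rewrite !inE /= => /strip_above aw /strip_above aw' /cells_between_inj.
case=> // -[e1] [e2]; rewrite -[w]zip_unzip -[w']zip_unzip.
by rewrite e1 e2.
Qed.

Section PolyOf.
Variables (K : nat) (w : seq (bool * bool)).
Hypothesis sw : strip K 1 w.

Lemma ncols_polyomino_of : ncols (polyomino_of w) = count (fun s => ~~ s.1) w.
Proof.
rewrite ncols_cells_between; last exact: strip_above sw.
by rewrite /= easts_cons add0n /easts take_size count_map.
Qed.

Lemma semiperimeter_polyomino_of :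
  (ncols (polyomino_of w) + nrows (polyomino_of w) = (size w).+1)%N.
Proof.
have aw := strip_above _ _ sw.
by rewrite ncols_cells_between // nrows_cells_between // subnKC ?easts_le //= size_map.
Qed.

Lemma area_polyomino_of : area (polyomino_of w) = word_area 1 w.
Proof.
rewrite area_cells_between; last exact: strip_above sw.
rewrite /= size_map big_ord_recl !easts0 add0n (word_areaE _ _ _ sw).
by apply: eq_bigr => k _; rewrite lift0 !easts_cons.
Qed.

End PolyOf.

Local Open Scope ring_scope.

(** * Solving the tridiagonal system with the polynomials r_n *)

Lemma ahatS (F : fieldType) (c q : F) n :
  ahat c q n.+1 =
  c * q ^+ n * (c * q ^+ n.+1) / ((1 - c * q ^+ n) * (1 - c * q ^+ n.+1)).
Proof.
rewrite /ahat.
have -> : 2 * n.+1%:Z - 1 = Posz (n + n).+1 by lia.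
have -> : n.+1%:Z - 1 = Posz n by lia.
rewrite -!exprnP !exprS exprD expr0.
by congr (_ / _); ring.
Qed.

Lemma r3_shift_horner (F : fieldType) (c q y : F) n :
  (r3_shift c q n.+2).[y] = (y - bhat c q n) * (r3_shift c q n.+1).[y]
  - y * ahat c q n * (r3_shift c q n).[y].
Proof. by rewrite [r3_shift c q n.+2]/= !hornerE. Qed.

Section Elimination.
Variables (F : fieldType) (x v q : F).
Hypotheses (x_neq0 : x != 0) (v_neq0 : v != 0) (q_neq0 : q != 0).
Hypothesis vq_neq1 : forall n, 1 - v * q ^+ n.+1 != 0.

Let den h := (r3_shift (v * q) q h.+1).[x^-1].
Let num h := (r3_shift (v * q ^+ 2) q h).[x^-1].
Let t h := v * q ^+ h.+1.

Let three_term h y z : F := (x^-1 - t h.+1 / (1 - t h.+1)) * z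
  - x^-1 * (t h * t h.+1 / ((1 - t h) * (1 - t h.+1))) * y.

Lemma tE n : v * q * q ^+ n = t n.
Proof. by rewrite /t exprS mulrA. Qed.

Lemma tSE n : v * q ^+ 2 * q ^+ n = t n.+1.
Proof. by rewrite /t !exprS expr0 mulr1 !mulrA. Qed.

Lemma den0 : den 0 = 1. Proof. by rewrite /den /= hornerE. Qed.
Lemma num0 : num 0 = 0. Proof. by rewrite /num /= hornerE. Qed.
Lemma num1 : num 1 = 1. Proof. by rewrite /num /= hornerE. Qed.
Lemma den1 : den 1 = x^-1 - t 0 / (1 - t 0).
Proof.
by rewrite /den r3_shift_horner /bhat tE /= !hornerE ?(mulr1, mulr0, subr0).
Qed.

Lemma denSS h : den h.+2 = three_term h (den h) (den h.+1).
Proof. by rewrite {1}/den r3_shift_horner ahatS /bhat !tE. Qed.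

(** The coefficients for c q at index h are those for c at index h + 1; this is
    why the numerators satisfy the recurrence of the denominators. *)
Lemma numSS h : num h.+2 = three_term h (num h) (num h.+1).
Proof.
rewrite {1}/num r3_shift_horner.
(* At h = 0 the coefficient of the last term is not of the generic form, but
   it multiplies the value of r_(-1) = 0. *)
case: h => [|h]; last by rewrite ahatS /bhat !tSE.
by rewrite /three_term num0 -[(r3_shift _ _ 0).[_]]/(num 0) num0 !mulr0 /bhat tSE.
Qed.

(** A common recurrence y_(h+2) = A_h y_(h+1) - B_h y_h multiplies the Casoratian
    of two solutions by B_h at each step, and here B_h is nonzero. *)
Lemma casoratian_neq0 h : den h.+1 * num h - den h * num h.+1 != 0.
Proof.
elim: h => [|h IH].
  by rewrite den0 num0 num1 mulr0 mulr1 sub0r oppr_eq0 oner_eq0.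
have -> : den h.+2 * num h.+1 - den h.+1 * num h.+2 =
  x^-1 * (t h * t h.+1 / ((1 - t h) * (1 - t h.+1)))
    * (den h.+1 * num h - den h * num h.+1).
  by rewrite denSS numSS /three_term; ring.
have t_neq0 i : t i != 0 by rewrite mulf_neq0 ?expf_neq0.
have t_neq1 i : 1 - t i != 0 by apply: vq_neq1.
apply: (mulf_neq0 _ IH); apply: mulf_neq0; first by rewrite invr_eq0.
by apply: mulf_neq0; rewrite ?invr_eq0; apply: mulf_neq0.
Qed.

Variables (m : nat) (g : nat -> F).
Hypotheses (g0 : g 0%N = 1) (gm : g m.+2 = 0).
Hypothesis gS : forall h, (h < m.+1)%N ->
  g h.+1 = t h * (g h.+2 + (1 + x) * g h.+1 + x * g h).

Let W h := \prod_(i < h) (t i / (x * (1 - t i))).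

(** Gaussian elimination: the h-th equation, solved for g_(h+1), expresses it by
    its two neighbours, and the recurrence of [den] and [num] is made so that
    the term in g_h cancels. *)
Lemma elimination h : (h <= m.+1)%N ->
  den h * g 1%N = t 0 / (1 - t 0) * num h + W h * g h.+1.
Proof.
have t_neq1 i : 1 - t i != 0 by apply: vq_neq1.
suff H k : (k <= m)%N ->
    den k * g 1%N = t 0 / (1 - t 0) * num k + W k * g k.+1 /\
    den k.+1 * g 1%N = t 0 / (1 - t 0) * num k.+1 + W k.+1 * g k.+2.
  by case: h => [_|h /H[]//]; case: (H 0%N isT).
elim: k => [_|k IH km].
  rewrite den0 num0 den1 num1 /W big_ord0 big_ord1; split; first by ring.
  have /eqP := gS 0 isT; rewrite g0 -subr_eq0 => /eqP e.
  apply/eqP; rewrite -subr_eq0; apply/eqP.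
  rewrite -[RHS](mulr0 (x * (1 - t 0))^-1) -e; field.
  by rewrite t_neq1 x_neq0.
have [e1 e2] := IH (ltnW km); split=> //.
have e := gS k.+1 km.
have -> : den k.+2 * g 1%N = three_term k (den k * g 1%N) (den k.+1 * g 1%N).
  by rewrite denSS /three_term; ring.
rewrite e1 e2 numSS /three_term.
move: e; rewrite /W !big_ord_recr /=; set P := \prod_(i < k) _ => /eqP.
rewrite -subr_eq0 => /eqP e.
apply/eqP; rewrite -subr_eq0; apply/eqP.
(* The two sides differ by W_(k+1) / (x (1 - t_(k+1))) times the equation e. *)
rewrite -[RHS](mulr0 (P * t k / (x * (1 - t k)) / (x * (1 - t k.+1)))) -e; field.
by rewrite !t_neq1 x_neq0.
Qed.

Lemma tridiagonal_solution : g 1%N = v * q / (1 - v * q) *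
  ((r3 (v * q ^+ 2) q m).[x^-1] / (r3 (v * q) q m.+1).[x^-1]).
Proof.
have e := elimination _ (leqnn m.+1).
rewrite gm mulr0 addr0 {1 2}/t expr1 in e.
have den_neq0 : den m.+1 != 0.
  (* Otherwise the numerator would vanish as well, hence the Casoratian. *)
  apply/eqP => d0; move: e; rewrite d0 mul0r => /esym/eqP.
  rewrite !mulf_eq0 invr_eq0 -{2}[q]expr1.
  rewrite (negPf v_neq0) (negPf q_neq0) (negPf (vq_neq1 0)) /= => /eqP n0.
  by have := casoratian_neq0 m.+1; rewrite d0 n0 mulr0 mul0r subr0 eqxx.
by rewrite mulrA; apply/(canRL (mulfK den_neq0)); rewrite mulrC.
Qed.

End Elimination.

(** * Generating functions *)

Lemma fps_coef_sum (R : zmodType) (I : Type) (r : seq I) (P : pred I) (F : I -> fps R) n :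
  (\sum_(i <- r | P i) F i) n = \sum_(i <- r | P i) F i n.
Proof. by apply: (big_morph (fun f : fps R => f n)). Qed.

(** The length of a word is its exponent of q^nu, and there are finitely many words
    of each length. The generating functions are therefore assembled from their
    homogeneous parts in q^nu, which are finite sums. *)
Definition qnu_homog (d : nat) (u : fps3) : Prop :=
  forall i j, j != d -> (u : fps (fps (fps rat))) i j = 0.

Lemma qnu_homog_coefM d (u f : fps3) i j : qnu_homog d u ->
  (u * f : fps (fps (fps rat))) i j = if (d <= j)%N then
    \sum_(k < i.+1) (u : fps (fps (fps rat))) k d *
                    (f : fps (fps (fps rat))) (i - k)%N (j - d)%N
  else 0.
Proof.
move=> ud; rewrite fps_coefM fps_coef_sum.
case: leqP => [dj|jd].
  apply: eq_bigr => k _; rewrite fps_coefM.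
  have dj1 : (d < j.+1)%N by [].
  rewrite (bigD1 (Ordinal dj1)) //= big1 ?addr0 // => l ld.
  by rewrite ud ?mul0r.
apply: big1 => k _; rewrite fps_coefM big1 // => l _.
by rewrite ud ?mul0r //; case: l => l /=; lia.
Qed.

Lemma qnu_homogM d e (u v : fps3) :
  qnu_homog d u -> qnu_homog e v -> qnu_homog (d + e) (u * v).
Proof.
move=> ud ve i j jde; rewrite (qnu_homog_coefM _ _ _ _ _ ud).
case: leqP => // dj; apply: big1 => k _; rewrite ve ?mulr0 //; lia.
Qed.

Lemma qnu_homog1 : qnu_homog 0 1.
Proof. by move=> [|i] [|j]. Qed.

Lemma qnu_homogX d u n : qnu_homog d u -> qnu_homog (n * d) (u ^+ n).
Proof.
move=> ud; elim: n => [|n IH]; first exact: qnu_homog1.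
rewrite exprS mulSn; exact: qnu_homogM ud IH.
Qed.

Lemma qnu_homog_x : qnu_homog 0 var_x.
Proof. by move=> [|[|i]] [|j]. Qed.

Lemma qnu_homog_qnu : qnu_homog 1 var_qnu.
Proof. by move=> [|i] [|[|j]]. Qed.

Lemma qnu_homog_q : qnu_homog 0 var_q.
Proof. by move=> [|i] [|j]. Qed.

(** For F j homogeneous of degree j in q^nu, this is the infinite sum of the F j. *)
Definition qnu_diag (F : nat -> fps3) : fps3 :=
  Fps (fun i => Fps (fun j => (F j : fps (fps (fps rat))) i j)).

Lemma qnu_diag_coef F i j :
  (qnu_diag F : fps (fps (fps rat))) i j = (F j : fps (fps (fps rat))) i j.
Proof. by []. Qed.

Lemma eq_qnu_diag F G : F =1 G -> qnu_diag F = qnu_diag G.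
Proof. by move=> FG; apply/fpsP => i; apply/fpsP => j; rewrite [LHS]/= FG. Qed.

Lemma qnu_diagM d (u : fps3) F : qnu_homog d u ->
  u * qnu_diag F = qnu_diag (fun j => if (d <= j)%N then u * F (j - d)%N else 0).
Proof.
move=> ud; apply/fpsP => i; apply/fpsP => j.
rewrite (qnu_homog_coefM _ _ _ _ _ ud) /=; case: leqP => // dj.
by rewrite (qnu_homog_coefM _ _ _ _ _ ud) dj.
Qed.

Lemma qnu_diag_sum (I : Type) (r : seq I) (F : I -> nat -> fps3) :
  \sum_(s <- r) qnu_diag (F s) = qnu_diag (fun j => \sum_(s <- r) F s j).
Proof.
apply/fpsP => i; apply/fpsP => j.
by rewrite 2!fps_coef_sum /= 2!fps_coef_sum.
Qed.

Definition step_pairs : seq (bool * bool) :=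
  [:: (true, true); (true, false); (false, true); (false, false)].

Fixpoint words (K h n : nat) : seq (seq (bool * bool)) :=
  if n is n'.+1 then
    if (0 < h <= K)%N then
      [seq s :: w | s <- step_pairs, w <- words K (next_height h s) n']
    else [::]
  else if h == 0%N then [:: [::]] else [::].

Lemma wordsS K h n : words K h n.+1 = if (0 < h <= K)%N then
  [seq s :: w | s <- step_pairs, w <- words K (next_height h s) n] else [::].
Proof. by []. Qed.

Lemma mem_words K h n w : (w \in words K h n) = (size w == n) && strip K h w.
Proof.
elim: n h w => [|n IH] h w; first by case: w => [|s w] /=; case: h.
rewrite wordsS.
case: ifP => hK; last by case: w => [|s w] //=; rewrite hK andbF.
apply/allpairsPdep/idP => [[s [w' [_ w'in ->]]] | ].
  by rewrite /= eqSS hK /= -IH.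
case: w => [|s w] //=; rewrite eqSS hK /= -IH => w_in.
by exists s, w; split=> //; case: s {w_in} => -[] [].
Qed.

Lemma words_uniq K h n : uniq (words K h n).
Proof.
elim: n h => [|n IH] h; first by rewrite /=; case: eqP.
rewrite wordsS; case: ifP => // _; apply: allpairs_uniq_dep => //.
by move=> [s w] [s' w'] _ _ /= [-> ->].
Qed.

Lemma monomialM (R : comNzRingType) (x v q : R) a b c d e :
  x ^+ (a + b) * v ^+ c.+1 * q ^+ (d + e) =
  x ^+ a * v * q ^+ d * (x ^+ b * v ^+ c * q ^+ e).
Proof. by rewrite !exprD exprS; ring. Qed.

Definition weight (h : nat) (w : seq (bool * bool)) : fps3 :=
  var_x ^+ count (fun s => ~~ s.1) w * var_qnu ^+ size w * var_q ^+ word_area h w.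

Definition step_weight (h : nat) (s : bool * bool) : fps3 :=
  var_x ^+ (~~ s.1) * var_qnu * var_q ^+ h.

Lemma weight_cons h s w :
  weight h (s :: w) = step_weight h s * weight (next_height h s) w.
Proof. exact: monomialM. Qed.

Lemma qnu_homog_weight h w : qnu_homog (size w) (weight h w).
Proof.
have hx := qnu_homogX _ _ (count (fun s => ~~ s.1) w) qnu_homog_x.
have hv := qnu_homogX _ _ (size w) qnu_homog_qnu.
have hq := qnu_homogX _ _ (word_area h w) qnu_homog_q.
have := qnu_homogM _ _ _ _ (qnu_homogM _ _ _ _ hx hv) hq.
by rewrite !muln0 muln1 add0n addn0.
Qed.

Lemma qnu_homog_step h s : qnu_homog 1 (step_weight h s).
Proof.
by have := qnu_homog_weight h [:: s]; rewrite weight_cons /weight !expr0 !mulr1.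
Qed.

Lemma fps3_sum_coef (I : choiceType) (A : set I) (F : I -> fps3) i j k :
  (fps3_sum A F : fps (fps (fps rat))) i j k =
  \sum_(a \in A) (F a : fps (fps (fps rat))) i j k.
Proof. by []. Qed.

Section Strip.
Variable K : nat.

Definition word_sum (h n : nat) : fps3 := \sum_(w <- words K h n) weight h w.

Definition strip_gf (h : nat) : fps3 := qnu_diag (word_sum h).

Lemma strip_gf0 : strip_gf 0 = 1.
Proof.
apply/fpsP => i; apply/fpsP => -[|j]; last first.
  by rewrite /= /word_sum big_nil qnu_homog1.
by rewrite [LHS]/= /word_sum big_seq1 /weight !expr0 !mulr1.
Qed.

(** Height K + 1 is outside of the strip, so no word starts there. *)
Lemma strip_gf_top : strip_gf K.+1 = 0.
Proof.
apply/fpsP => i; apply/fpsP => j.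
by rewrite /= /word_sum; case: j => [|j]; rewrite /= ?ltnn big_nil.
Qed.

Lemma word_sum0 h : (0 < h)%N -> word_sum h 0 = 0.
Proof. by case: h => // h _; rewrite /word_sum big_nil. Qed.

Lemma word_sumS h n : (0 < h <= K)%N ->
  word_sum h n.+1 = \sum_(s <- step_pairs) step_weight h s * word_sum (next_height h s) n.
Proof.
move=> hK; rewrite /word_sum wordsS hK big_allpairs_dep.
apply: eq_bigr => s _; rewrite mulr_sumr; apply: eq_bigr => w _; exact: weight_cons.
Qed.

Lemma strip_gf_steps h : (0 < h <= K)%N ->
  strip_gf h = \sum_(s <- step_pairs) step_weight h s * strip_gf (next_height h s).
Proof.
move=> hK; have sum_parts n : word_sum h n = \sum_(s <- step_pairs)
    (if (1 <= n)%N then step_weight h s * word_sum (next_height h s) (n - 1)%N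
     else 0).
  case: n => [|n]; last by rewrite (word_sumS _ _ hK) subn1.
  by have /andP[h_gt0 _] := hK; rewrite word_sum0 // big1.
under eq_bigr => s _ do rewrite /strip_gf (qnu_diagM _ _ _ (qnu_homog_step h s)).
rewrite qnu_diag_sum; exact: eq_qnu_diag sum_parts.
Qed.

Lemma letters_sum (R : comNzRingType) (x v y g_lo g g_hi : R) :
  x ^+ 0 * v * y * g + (x ^+ 0 * v * y * g_hi +
    (x ^+ 1 * v * y * g_lo + (x ^+ 1 * v * y * g + 0))) =
  v * y * (g_hi + (1 + x) * g + x * g_lo).
Proof. by ring. Qed.

(** Of the four kinds of letters, two keep the height; an east step of the upper
    path carries the factor x. *)
Lemma strip_gfS h : (0 < h <= K)%N ->
  strip_gf h = var_qnu * var_q ^+ h *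
    (strip_gf h.+1 + (1 + var_x) * strip_gf h + var_x * strip_gf h.-1).
Proof.
move=> hK; rewrite {1}strip_gf_steps // /step_pairs !big_cons big_nil.
have -> : next_height h (true, true) = h by rewrite /next_height addnK.
have -> : next_height h (true, false) = h.+1 by rewrite /next_height subn0 addn1.
have -> : next_height h (false, true) = h.-1 by rewrite /next_height addn0 subn1.
have -> : next_height h (false, false) = h by rewrite /next_height addn0 subn0.
exact: letters_sum.
Qed.

Lemma monomial_split (R : comNzRingType) (x v q : R) a b n c :
  (a + b)%N = n.+1 ->
  (v * x) ^+ a * v ^+ b * q ^+ c = v * (x ^+ a * v ^+ n * q ^+ c).
Proof.
move=> abn; have v_ab : v ^+ a * v ^+ b = v * v ^+ n by rewrite -exprD abn exprS.
transitivity (v ^+ a * v ^+ b * (x ^+ a * q ^+ c)); first by rewrite exprMn; ring.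
by rewrite v_ab; ring.
Qed.

(** In the sum over polyominoes only those of semiperimeter j contribute to the
    exponent j of q^nu; their words without the first letter have length j - 1,
    and the first letter contributes the factor q^nu. *)
Lemma polyomino_gf :
  fps3_sum (polyominoes_le K) (fun alpha =>
    (var_qnu * var_x) ^+ ncols alpha * var_qnu ^+ nrows alpha
      * var_q ^+ area alpha) = var_qnu * strip_gf 1.
Proof.
rewrite /strip_gf (qnu_diagM _ _ _ qnu_homog_qnu).
apply/fpsP => i; apply/fpsP => j; apply/fpsP => k.
rewrite fps3_sum_coef qnu_diag_coef polyominoes_leE.
rewrite fsbig_image; last exact: polyomino_of_inj.
set G := (G in \sum_(w \in _) G w).
have GE w : strip K 1 w -> G w = (var_qnu * weight 1 w : fps (fps (fps rat))) i j k.
  move=> sw; rewrite /G (area_polyomino_of _ _ sw).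
  rewrite (monomial_split _ _ _ _ _ _ _ _ (semiperimeter_polyomino_of _ _ sw)).
  by rewrite (ncols_polyomino_of _ _ sw).
clearbody G; pose r := if (0 < j)%N then words K 1 j.-1 else [::].
have r_strip w : w \in r -> strip K 1 w.
  by rewrite /r; case: ifP => // _; rewrite mem_words => /andP[].
have r_uniq : uniq r by rewrite /r; case: ifP => // _; apply: words_uniq.
have r_sub : ([set` r] `<=` [set w | strip K 1 w])%classic by move=> w /r_strip.
have G_out w : strip K 1 w -> w \notin r -> G w = 0.
  move=> sw w_r; rewrite (GE _ sw).
  rewrite (qnu_homogM _ _ _ _ qnu_homog_qnu (qnu_homog_weight 1 w)) //.
  apply: contraNneq w_r => jw; rewrite /r jw mem_words eqxx; exact: sw.
rewrite (fsbigE r G r_uniq r_sub G_out).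
pose wt w := (var_qnu * weight 1 w : fps (fps (fps rat))) i j k.
rewrite big_mkcond (eq_big_seq wt); last first.
  move=> w /r_strip sw; rewrite (GE _ sw).
  by rewrite (mem_set (sw : [set w | strip K 1 w]%classic w)).
rewrite /wt /r; case: j {G GE r wt r_strip r_uniq r_sub G_out} => [|n].
  by rewrite big_nil.
rewrite subn1 -[RHS]/((var_qnu * word_sum 1 n : fps (fps (fps rat))) i n.+1 k).
by rewrite /word_sum mulr_sumr !fps_coef_sum.
Qed.

End Strip.

Lemma var_x_neq0 : var_x != 0.
Proof.
apply/eqP => /fpsP/(_ 1%N)/fpsP/(_ 0%N)/fpsP/(_ 0%N)/eqP.
by rewrite /= oner_eq0.
Qed.

Lemma var_qnu_neq0 : var_qnu != 0.
Proof.
apply/eqP => /fpsP/(_ 0%N)/fpsP/(_ 1%N)/fpsP/(_ 0%N)/eqP.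
by rewrite /= oner_eq0.
Qed.

Lemma var_q_neq0 : var_q != 0.
Proof.
apply/eqP => /fpsP/(_ 0%N)/fpsP/(_ 0%N)/fpsP/(_ 1%N)/eqP.
by rewrite /= oner_eq0.
Qed.

Lemma one_sub_qnu_neq0 n : 1 - var_qnu * var_q ^+ n != 0.
Proof.
have homog : qnu_homog (1 + n * 0) (var_qnu * var_q ^+ n).
  by apply: qnu_homogM qnu_homog_qnu _; apply: qnu_homogX qnu_homog_q.
rewrite subr_eq0; apply/eqP => /fpsP/(_ 0%N)/fpsP/(_ 0%N).
rewrite homog ?muln0 // => /fpsP/(_ 0%N)/eqP.
by rewrite /= oner_eq0.
Qed.

Lemma tofrac_recurrence (R : idomainType) (x v q g_lo g g_hi : R) n :
  tofrac (v * q ^+ n * (g_hi + (1 + x) * g + x * g_lo)) =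
  tofrac v * tofrac q ^+ n *
    (tofrac g_hi + (1 + tofrac x) * tofrac g + tofrac x * tofrac g_lo).
Proof. by rewrite !(rmorphM, rmorphD, rmorph1, rmorphXn). Qed.

Theorem theorem6p9 (m : nat) :
  let x : {fraction fps3} := tofrac var_x in
  let qnu : {fraction fps3} := tofrac var_qnu in
  let q : {fraction fps3} := tofrac var_q in
  tofrac (fps3_sum (polyominoes_le m.+1) (fun alpha =>
    (var_qnu * var_x) ^+ ncols alpha * var_qnu ^+ nrows alpha
      * var_q ^+ area alpha)) =
  qnu ^+ 2 * q / (1 - qnu * q) *
    ((r3 (qnu * q ^+ 2) q m).[x^-1] / (r3 (qnu * q) q m.+1).[x^-1]).
Proof.
move=> x qnu q.
rewrite polyomino_gf rmorphM /= -/qnu.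
rewrite (@tridiagonal_solution _ x qnu q _ _ _ _ m
           (fun h => tofrac (strip_gf m.+1 h))) /=.
- by rewrite expr2 !mulrA.
- by rewrite tofrac_eq0 var_x_neq0.
- by rewrite tofrac_eq0 var_qnu_neq0.
- by rewrite tofrac_eq0 var_q_neq0.
- move=> n; rewrite -(rmorph1 (@tofrac fps3)) -rmorphXn -rmorphM -rmorphB /=.
  by rewrite tofrac_eq0 one_sub_qnu_neq0.
- by rewrite strip_gf0 rmorph1.
- by rewrite strip_gf_top rmorph0.
move=> h hm; rewrite {1}(strip_gfS _ h.+1 hm).
exact: tofrac_recurrence.
Qed.
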